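(* Let $(V_1,V_2)$ be a pair of commuting isometries on a Hilbert space $\mathcal{H}$. Then the following are equivalent: (a) $C(V_1,V_2)\ge0$. (b) $V_2\mathcal{W}_1\subseteq\mathcal{W}_1$. (c) $(V_1,V_2)$ is doubly commuting. (d) $C(V_1,V_2)$ is a projection. (e) The fringe operator $F_2$ is an isometry.
   Context: The pair is not assumed to be pure. The defect operator of $(V_1,V_2)$ is the self-adjoint operator $C(V_1,V_2)=I-V_1V_1^*-V_2V_2^*+V_1V_2V_1^*V_2^*$ on $\mathcal{H}$. $\mathcal{W}_j=\mathcal{H}\ominus V_j\mathcal{H}=\ker V_j^*$ for $j=1,2$. The pair $(V_1,V_2)$ is doubly commuting if $V_1V_2=V_2V_1$ and $V_1^*V_2=V_2V_1^*$. The fringe operator $F_2\in\mathcal{B}(\mathcal{W}_1)$ is $F_2=P_{\mathcal{W}_1}V_2|_{\mathcal{W}_1}$, where $P_{\mathcal{W}_1}$ is the orthogonal projection onto $\mathcal{W}_1$. ''Projection'' means orthogonal projection. *)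

(* Defs.v *)
From HB Require Import structures.
From mathcomp Require Import all_boot all_order all_algebra.
From mathcomp Require Import complex.
From mathcomp Require Import all_classical all_reals all_analysis.

Set Implicit Arguments.
Unset Strict Implicit.
Unset Printing Implicit Defensive.

Import Order.TTheory GRing.Theory Num.Theory.
Import numFieldNormedType.Exports.

Local Open Scope classical_set_scope.
Local Open Scope ring_scope.
Local Open Scope complex_scope.

(* [inner x y] is linear in [x] and conjugate-linear in [y].  Completeness is
   carried by the underlying complete normed module. *)
Record hilbertType (R : realType) := HilbertType {
  hilbert_sort :> completeNormedModType R[i];
  inner : {dot hilbert_sort for Num.conj};
  inner_norm : forall x : hilbert_sort, `|x| ^+ 2 = inner x x }.

Notation "''[' x , y ]" := (inner _ x y) : ring_scope.

Section HilbertOperators.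
Context {R : realType} {H : hilbertType R}.
Implicit Types (T V : H -> H) (W : set H).

Definition is_adjoint T S := forall x y : H, '[T x, y] = '[x, S y].

(* Meaningful for bounded linear [T], for which exactly one adjoint exists. *)
Definition adjoint T : H -> H := xget (fun=> 0) (is_adjoint T).

Definition orthogonal_complement W : set H :=
  [set x | forall y, W y -> '[x, y] = 0].

Definition closed_subspace W :=
  [/\ W 0, (forall (a : R[i]) (x y : H), W x -> W y -> W (a *: x + y))
    & closed W].

(* Meaningful for a closed subspace [W], for which there is exactly one such
   point for each [x]. *)
Definition orthoproj W (x : H) : H :=
  xget 0 [set w | W w /\ orthogonal_complement W (x - w)].

Definition is_projection T :=
  exists2 W : set H, closed_subspace W & T =1 orthoproj W.

(* In the order of [R[i]], [0 <= z] means that [z] is real and nonnegative. *)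
Definition positive_operator T := forall x : H, 0 <= '[T x, x].

(* [T], restricted to [W], is a norm-preserving map from [W] to [W]. *)
Definition isometry_on W T :=
  forall x : H, W x -> W (T x) /\ `|T x| = `|x|.

Definition wandering V : set H := orthogonal_complement (range V).

Definition defect_operator V1 V2 (x : H) : H :=
  x - V1 (adjoint V1 x) - V2 (adjoint V2 x)
    + V1 (V2 (adjoint V1 (adjoint V2 x))).

Definition doubly_commuting V1 V2 :=
  V1 \o V2 =1 V2 \o V1 /\ adjoint V1 \o V2 =1 V2 \o adjoint V1.

(* The fringe operator F_2 is the restriction of this map to [wandering V1]. *)
Definition fringe2 V1 V2 (x : H) : H := orthoproj (wandering V1) (V2 x).

End HilbertOperators.

(* Main.v *)
Require Import Defs.
From HB Require Import structures.
From mathcomp Require Import all_boot all_order all_algebra.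
From mathcomp Require Import complex lra.
From mathcomp Require Import all_classical all_reals all_analysis.

Import Order.TTheory GRing.Theory Num.Theory.
Import numFieldNormedType.Exports.

Local Open Scope classical_set_scope.
Local Open Scope ring_scope.
Set Implicit Arguments.
Unset Strict Implicit.

(** Write A_j for the adjoint of V_j, so that A_j V_j = I and W_j = ker A_j.
Everything rests on a few identities between these operators.

For w in W_1, the terms of C(V_1,V_2) cancel on V_2 w down to
C V_2 w = - V_1 A_1 V_2 w, hence <C V_2 w, V_2 w> = - |A_1 V_2 w|^2.  Positivity
of C therefore forces A_1 V_2 w = 0, that is, V_2 w in W_1
([positive_invariant]).  If V_2 preserves W_1, apply A_1 V_2 to the decomposition
x = V_1 A_1 x + (x - V_1 A_1 x) of x along V_1 H and W_1: the second part
contributes nothing, and commutativity turns the first into V_2 A_1 x, which is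
double commutation ([invariant_doubly_commuting]).  If the pair is doubly
commuting, then C = (I - V_1 A_1)(I - V_2 A_2) is the orthogonal projection onto
the intersection of W_1 and W_2 ([doubly_commuting_projection]); and every
projection is positive ([projection_positive]), which closes the cycle of the
first four conditions.

As for the fringe operator, Pythagoras gives
|V_2 x|^2 = |F_2 x|^2 + |A_1 V_2 x|^2, while |V_2 x| = |x|.  So F_2 preserves the
norm of x in W_1 exactly when V_2 x lies in W_1, and its isometry is equivalent
to the invariance of W_1 ([fringe_invariant], [invariant_fringe]).

The analytic content is that an isometry V has an adjoint at all
([is_adjoint_adjoint]).  The range of V contains a point V z nearest to y:
by the parallelogram law a minimizing sequence is Cauchy, and completeness
provides its limit ([nearest_point]).  The residue y - V z of a nearest point is
orthogonal to the range ([orthogonal_of_minimal]), and z is then the value of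
the adjoint at y. *)

(** * Inner products and orthogonality *)

Section HilbertSpace.
Context {R : realType} {H : hilbertType R}.
Implicit Types (x y z u v : H).

Lemma innerC x y : '[x, y] = Num.conj '[y, x].
Proof. by have := hermC (@inner R H) x y; rewrite expr0 mul1r. Qed.

Lemma is_adjoint_sym (T S : H -> H) : is_adjoint T S -> is_adjoint S T.
Proof. by move=> TS x y; rewrite innerC -TS -innerC. Qed.

(** This reduces an identity between values of adjoints to one between inner
products, where the adjoints can be moved to the other side. *)
Lemma inner_sep u v : (forall x, '[x, u] = '[x, v]) -> u = v.
Proof.
move=> uv; apply/eqP; rewrite -subr_eq0 -(@dnorm_eq0 _ _ (@inner R H)).
by rewrite linearBr /= uv subrr.
Qed.

Lemma parallelogram x y :
  `|x + y| ^+ 2 + `|x - y| ^+ 2 = (`|x| ^+ 2 + `|y| ^+ 2) *+ 2.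
Proof.
rewrite !inner_norm dnormD dnormB.
by rewrite addrACA subrr addr0 -mulr2n.
Qed.

(** Subtracting from u its component along v, with the coefficient
a = <u,v> / <v,v>, lowers |u|^2 by |<u,v>|^2 / <v,v>; if u is already of minimal
norm in u + C v, this amount vanishes. *)
Lemma orthogonal_of_minimal u v :
  (forall a : R[i], `|u| <= `|u - a *: v|) -> '[u, v] = 0.
Proof.
move=> umin; have [->|v0] := eqVneq v 0; first by rewrite linear0r.
have N0 : 0 < '[v, v] by rewrite dnorm_gt0.
set c := '[u, v]; set a := c / '[v, v].
have ca : '[u, a *: v] = `|c| ^+ 2 / '[v, v].
  rewrite linearZr_LR /= -/c rmorphM fmorphV /= -innerC.
  by rewrite normCK mulrC mulrA.
have := umin a; rewrite -ler_sqr ?nnegrE// !inner_norm dnormB dnormZ ca.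
have -> : Num.conj (`|c| ^+ 2 / '[v, v]) = `|c| ^+ 2 / '[v, v].
  by rewrite rmorphM fmorphV /= -innerC rmorphXn /= conj_normC.
have -> : `|a| ^+ 2 * '[v, v] = `|c| ^+ 2 / '[v, v].
  rewrite /a normrM normfV (ger0_norm (ltW N0)) exprMn exprVn.
  by rewrite -mulrA; congr (_ * _); rewrite expr2 invfM mulrVK ?unitfE ?gt_eqF.
rewrite -addrA lerDl opprD addrA subrr sub0r oppr_ge0 pmulr_lle0 ?invr_gt0//.
by move=> h; apply/eqP; rewrite -normr_eq0 -sqrf_eq0 eq_le h exprn_ge0.
Qed.

(** Two candidates for the projection differ by a vector that lies both in W and
in its orthogonal complement. *)
Lemma orthoproj_unique (W : set H) x w : closed_subspace W ->
  W w -> orthogonal_complement W (x - w) -> orthoproj W x = w.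
Proof.
case=> _ WD _ Ww xw; apply: xget_unique => // w' [Ww' xw'].
apply/eqP; rewrite -subr_eq0 -(@dnorm_eq0 _ _ (@inner R H)).
have Wd : W (w' - w) by rewrite addrC -scaleN1r; exact: WD.
have {1}-> : w' - w = (x - w) - (x - w').
  by rewrite opprB [RHS]addrC addrA subrK.
by rewrite linearBl /= xw// xw'// subrr.
Qed.

(** If x = w + t with w in W and t orthogonal to W, then <w, x> = <w, w>.  A point
without such a decomposition is sent by [orthoproj] to its default value 0, where
the form vanishes. *)
Lemma projection_positive (T : H -> H) : is_projection T -> positive_operator T.
Proof.
case=> W _ TW x; rewrite TW /orthoproj; case: xgetP => [w _ [Ww xw]|_].
  by rewrite -[x in '[_, x]](subrK w) linearDr /= innerC xw// rmorph0 add0r.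
by rewrite linear0l.
Qed.

(** * Isometries and their adjoints *)

Section Isometry.
Variable V : {linear H -> H}.
Hypothesis V_isometry : isometry_on [set: H] V.

Lemma isometry_norm x : `|V x| = `|x|.
Proof. by have [] := @V_isometry x I. Qed.

(** Polarization: comparing |V (u + v)| with |u + v| gives equality of the real
parts of <V u, V v> and <u, v>, and replacing u by i u that of the imaginary
parts. *)
Lemma isometry_inner x y : '[V x, V y] = '[x, y].
Proof.
have sum_conj u v :
    '[V u, V v] + Num.conj '[V u, V v] = '[u, v] + Num.conj '[u, v].
  have := congr1 (fun t => t ^+ 2) (isometry_norm (u + v)).
  rewrite !inner_norm linearD !dnormD -!inner_norm !isometry_norm.
  exact: addrI.
have := sum_conj ('i *: x) y.
rewrite linearZ !linearZl_LR /= !rmorphM /= !conjCi !mulNr -!mulrBr.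
move/(mulfI (neq0Ci _)) => hB.
have double (s t : R[i]) : s + t + (s - t) = s *+ 2.
  by rewrite addrACA subrr addr0 mulr2n.
apply/eqP; rewrite -(eqr_pMn2r (n := 2))// -(double _ (Num.conj '[V x, V y])).
by rewrite sum_conj hB double.
Qed.

(** The nearest-point theorem for the range of V.  Since V is an isometry, the
Cauchy property of a minimizing sequence V z_n passes to z_n itself, and the limit
is taken in the domain of V. *)
Lemma nearest_point y : exists z, forall x, `|y - V z| <= `|y - V x|.
Proof.
pose dist x := complex.Re `|y - V x|.
have distE x : `|y - V x| = (dist x)%:C%C by rewrite RRe_real ?normr_real.
have dist_ge0 x : 0 <= dist x by rewrite -lecR -distE normr_ge0.
pose d := inf (range dist).
have d_inf : has_inf (range dist).
  by split; [exists (dist 0), 0 | exists 0 => _ [x _ <-]].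
have d_le x : d <= dist x by apply: ge_inf; [case: d_inf | exists x].
have d_ge0 : 0 <= d by apply: lb_le_inf; [case: d_inf | move=> _ [x _ <-]].
have approx (n : nat) : exists z, dist z < d + n.+1%:R^-1.
  have n0 : 0 < n.+1%:R^-1 :> R by rewrite invr_gt0.
  by have [_ [z _ <-]] := inf_adherent n0 d_inf; exists z.
have [z_ z_lt] := choice approx.
(* The parallelogram law for y - V u and y - V v, whose half-sum is the residue
   at the midpoint of u and v and so has norm at least d. *)
have gap u v : `|u - v| ^+ 2 <=
    ((dist u ^+ 2 + dist v ^+ 2) *+ 2 - (d *+ 2) ^+ 2)%:C%C.
  have mid : (d *+ 2)%:C%C <= `|(y - V u) + (y - V v)|.
    have -> : (y - V u) + (y - V v) = 2 *: (y - V (2^-1 *: (u + v))).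
      rewrite scalerBr (linearZ_LR V) /= scalerA mulfV ?pnatr_eq0//.
      by rewrite scale1r (linearD V) addrACA -opprD scaler_nat mulr2n.
    by rewrite normrZ distE normr_nat rmorphMn mulr_natl lerMn2r lecR d_le orbT.
  have := parallelogram (y - V u) (y - V v).
  have -> : (y - V u) - (y - V v) = - V (u - v).
    by rewrite (linearB V) opprD addrACA subrr add0r -opprD.
  move/(canRL (addKr _)); rewrite normrN isometry_norm => ->.
  rewrite !distE rmorphB rmorphMn rmorphD !rmorphXn /= [leLHS]addrC lerD2l lerN2.
  by rewrite ler_sqr ?nnegrE// ler0c mulrn_wge0.
have z_cauchy : cauchy (z_ @ \oo).
  apply: cauchy_exP => e e_gt0.
  have eE : (complex.Re e)%:C%C = e by rewrite RRe_real ?gtr0_real.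
  move: (complex.Re e) eE e_gt0 => r <-; rewrite ltcR => r_gt0 {e}.
  (* If V u and V v are at distance less than d + delta from y, then |u - v|^2
     is below 4 (d + delta)^2 - 4 d^2, which is at most (8 d + 4) delta when
     delta <= 1. *)
  pose delta := Num.min 1 (r ^+ 2 / (d * 8 + 4)).
  have k_gt0 : 0 < d * 8 + 4 by rewrite ltr_wpDl ?mulr_ge0.
  have delta_gt0 : 0 < delta by rewrite lt_min ltr01 divr_gt0 ?exprn_gt0.
  have delta_le1 : delta <= 1 by rewrite ge_min lexx.
  have delta_le : delta * (d * 8 + 4) <= r ^+ 2.
    by rewrite -ler_pdivlMr// ge_min lexx orbT.
  have [N _ N_lt] := near_infty_natSinv_lt (PosNum delta_gt0).
  have dist_lt n : (N <= n)%N -> dist (z_ n) < d + delta.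
    by move=> /N_lt /= n_lt; rewrite (lt_trans (z_lt n))// ltrD2l.
  exists (z_ N); exists N => // n /= Nn.
  rewrite -ball_normE /= -ltr_sqr ?nnegrE ?ler0c ?(ltW r_gt0)//.
  rewrite (le_lt_trans (gap _ _))// -rmorphXn ltcR.
  have := dist_lt _ (leqnn N); have := dist_lt _ Nn.
  have := dist_ge0 (z_ N); have := dist_ge0 (z_ n).
  move: (dist _) (dist _) => a b a_ge0 b_ge0 a_lt b_lt.
  have a2 : a ^+ 2 < (d + delta) ^+ 2 by nra.
  have b2 : b ^+ 2 < (d + delta) ^+ 2 by nra.
  nra.
have [z z_cvg] : exists z, z_ @ \oo --> z.
  by apply/cvg_ex; exact: cauchy_cvg.
exists z => x; rewrite distE [leRHS]distE lecR (le_trans _ (d_le x))//.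
apply/ler_addgt0Pl => e e_gt0; rewrite [e]splitr -lecR -distE.
have e2_gt0 : 0 < e / 2 by rewrite divr_gt0.
near \oo => n.
rewrite (le_trans (ler_distD (V (z_ n)) _ _))// distE -linearB isometry_norm.
rewrite -addrA [leRHS]rmorphD [leRHS]addrC /=; apply: lerD.
  rewrite lecR (le_trans (ltW (z_lt n)))// [leLHS]addrC lerD2r ltW//.
  by near: n; exact: near_infty_natSinv_lt (PosNum e2_gt0).
rewrite distrC ltW//; near: n.
by move/cvgrPdist_lt : z_cvg; apply; rewrite ltcR.
Unshelve. all: by end_near. Qed.

(** The adjoint sends y to the z for which V z is nearest to y. *)
Lemma is_adjoint_adjoint : is_adjoint V (adjoint V).
Proof.
apply: (@xgetPex _ _ (is_adjoint V)).
have /choice [A A_near] := nearest_point.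
exists A => x y.
rewrite -[RHS]isometry_inner -[in LHS](subrK (V (A y)) y) linearDr /= innerC.
rewrite orthogonal_of_minimal ?rmorph0 ?add0r// => a.
by rewrite -addrA -opprD -linearZ -linearD A_near.
Qed.

Local Notation A := (adjoint V).

Lemma adjointD : {morph A : x y / x + y}.
Proof.
move=> x y; apply: inner_sep => t.
by rewrite linearDr /= -!is_adjoint_adjoint linearDr.
Qed.

Lemma adjointB : {morph A : x y / x - y}.
Proof.
move=> x y; apply: inner_sep => t.
by rewrite linearBr /= -!is_adjoint_adjoint linearBr.
Qed.

Lemma adjointK : cancel V A.
Proof.
by move=> x; apply: inner_sep => t; rewrite -is_adjoint_adjoint isometry_inner.
Qed.

Lemma wanderingE x : wandering V x <-> A x = 0.
Proof.
split=> [Wx|Ax0 _ [y _ <-]].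
  apply: inner_sep => t.
  by rewrite -is_adjoint_adjoint linear0r innerC Wx ?rmorph0.
by rewrite innerC is_adjoint_adjoint Ax0 linear0r rmorph0.
Qed.

Lemma wandering_residue x : wandering V (x - V (A x)).
Proof. by apply/wanderingE; rewrite adjointB adjointK subrr. Qed.

(** Pythagoras for the decomposition of x along the wandering subspace and the
range of V. *)
Lemma norm_adjoint_split x : `|x| ^+ 2 = `|x - V (A x)| ^+ 2 + `|A x| ^+ 2.
Proof.
rewrite -(isometry_norm (A x)) !inner_norm -hnormDd ?subrK//.
by apply: (wandering_residue x); exists (A x).
Qed.

Lemma adjoint_contraction x : `|A x| <= `|x|.
Proof.
by rewrite -ler_sqr ?nnegrE// (norm_adjoint_split x) lerDr exprn_ge0.
Qed.

(** Continuity of the adjoint is what makes its kernel, the wandering subspace,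
closed. *)
Lemma adjoint_continuous : continuous A.
Proof.
move=> x; apply/cvgrPdist_lt => e e_gt0; near=> y.
rewrite -adjointB; apply: le_lt_trans (adjoint_contraction _) _.
by near: y; exact: cvgr_dist_lt.
Unshelve. all: by end_near. Qed.

Lemma wandering_closed_subspace : closed_subspace (wandering V).
Proof.
split.
- by move=> y _; rewrite linear0l.
- by move=> a x y Wx Wy t Vt; rewrite linearPl /= Wx// Wy// mulr0 addr0.
- have -> : wandering V = A @^-1` [set 0].
    by apply/seteqP; split=> x /wanderingE.
  apply: closed_comp => [x _|]; first exact: adjoint_continuous.
  exact/accessible_closed_set1/hausdorff_accessible/norm_hausdorff.
Qed.

Lemma orthoproj_wandering x : orthoproj (wandering V) x = x - V (A x).
Proof.
apply: orthoproj_unique; first exact: wandering_closed_subspace.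
  exact: wandering_residue.
by move=> y Wy; rewrite opprB addrCA subrr addr0 innerC Wy ?rmorph0.
Qed.

End Isometry.

(** * Pairs of commuting isometries *)

Section Pair.
Variables V1 V2 : {linear H -> H}.
Hypothesis V1_isometry : isometry_on [set: H] V1.
Hypothesis V2_isometry : isometry_on [set: H] V2.
Hypothesis V12_commute : V1 \o V2 =1 V2 \o V1.
Local Notation A1 := (adjoint V1).
Local Notation A2 := (adjoint V2).
Let A1P := is_adjoint_adjoint V1_isometry.
Let A2P := is_adjoint_adjoint V2_isometry.

Lemma adjoint_commute x : A1 (A2 x) = A2 (A1 x).
Proof.
by apply: inner_sep => t; rewrite -!(A1P, A2P); have /= -> := V12_commute t.
Qed.

(** For w in the wandering subspace of V1, the quadratic form of the defect
operator at V2 w is - |A1 (V2 w)|^2. *)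
Lemma positive_invariant :
  positive_operator (defect_operator V1 V2) ->
  V2 @` wandering V1 `<=` wandering V1.
Proof.
move=> C_ge0 _ [w /(wanderingE V1_isometry) A1w <-].
apply/(wanderingE V1_isometry)/eqP.
rewrite -(@dnorm_eq0 _ _ (@inner R H)) eq_le dnorm_ge0 andbT.
have := C_ge0 (V2 w); rewrite /defect_operator (adjointK V2_isometry) A1w.
rewrite !linear0 addr0 addrAC subrr sub0r linearNl /= A1P.
by rewrite oppr_ge0.
Qed.

(** A1 V2 vanishes on the wandering part x - V1 (A1 x) of x, while
A1 V2 V1 (A1 x) = A1 V1 V2 (A1 x) = V2 (A1 x). *)
Lemma invariant_doubly_commuting :
  V2 @` wandering V1 `<=` wandering V1 -> doubly_commuting V1 V2.
Proof.
move=> V2W; split=> // x /=.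
have /wanderingE : wandering V1 (V2 (x - V1 (A1 x))).
  by apply: V2W; exists (x - V1 (A1 x)) => //; exact: wandering_residue.
move=> /(_ V1_isometry); rewrite linearB adjointB//.
have /= <- := V12_commute (A1 x).
by rewrite (adjointK V1_isometry) => /eqP; rewrite subr_eq0 => /eqP.
Qed.

(** Double commutation makes A1 C and A2 C vanish, so that C maps into the
intersection of the two wandering subspaces; and x - C x is a sum of vectors from
the ranges of V1 and V2, hence orthogonal to that intersection. *)
Lemma doubly_commuting_projection :
  doubly_commuting V1 V2 -> is_projection (defect_operator V1 V2).
Proof.
move=> [_ A1V2]; have {}A1V2 x : A1 (V2 x) = V2 (A1 x) := A1V2 x.
have A2V1 x : A2 (V1 x) = V1 (A2 x).
  apply: inner_sep => t.
  by rewrite -A2P -!(is_adjoint_sym A1P) A1V2 A2P.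
pose W := wandering V1 `&` wandering V2.
have W_subspace : closed_subspace W.
  have [W10 W1D W1c] := wandering_closed_subspace V1_isometry.
  have [W20 W2D W2c] := wandering_closed_subspace V2_isometry.
  split=> //; last exact: closedI.
  by move=> a x y [? ?] [? ?]; split; [exact: W1D | exact: W2D].
exists W => // x; apply/esym/orthoproj_unique => //.
  split; apply/wanderingE => //.
    rewrite /defect_operator adjointD// !adjointB// !(adjointK V1_isometry).
    by rewrite A1V2 subrr sub0r addNr.
  have /= V12 := V12_commute (A1 (A2 x)).
  rewrite /defect_operator V12 adjointD// !adjointB// !(adjointK V2_isometry).
  by rewrite A2V1 adjoint_commute [_ - _ - _]addrAC subrr sub0r addNr.
move=> y [/(wanderingE V1_isometry) A1y /(wanderingE V2_isometry) A2y].
rewrite /defect_operator linearBl linearDl !linearBl /= !A1P A2P A1y A2y.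
by rewrite !linear0r !subr0 addr0 subrr.
Qed.

(** When V2 preserves the wandering subspace of V1, the fringe operator is just
the restriction of V2 to it. *)
Lemma invariant_fringe :
  V2 @` wandering V1 `<=` wandering V1 ->
  isometry_on (wandering V1) (fringe2 V1 V2).
Proof.
move=> V2W x W1x.
have WV2x : wandering V1 (V2 x) by apply: V2W; exists x.
have -> : fringe2 V1 V2 x = V2 x.
  rewrite /fringe2 orthoproj_wandering//.
  by move/(wanderingE V1_isometry): WV2x => ->; rewrite linear0 subr0.
by rewrite (isometry_norm V2_isometry).
Qed.

(** An isometric fringe operator leaves no room, in the Pythagorean splitting of
V2 x, for the component A1 (V2 x). *)
Lemma fringe_invariant :
  isometry_on (wandering V1) (fringe2 V1 V2) ->
  V2 @` wandering V1 `<=` wandering V1.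
Proof.
move=> F_isometry _ [x W1x <-]; apply/(wanderingE V1_isometry)/eqP.
have [_] := F_isometry x W1x; rewrite /fringe2 orthoproj_wandering// => Fx.
have := norm_adjoint_split V1_isometry (V2 x).
rewrite Fx isometry_norm// -[LHS]addr0 => /addrI /esym /eqP.
by rewrite sqrf_eq0 normr_eq0.
Qed.

End Pair.

End HilbertSpace.

Theorem theorem6p5 (R : realType) (H : hilbertType R) (V1 V2 : {linear H -> H})
    (V1_isometry : isometry_on [set: H] V1)
    (V2_isometry : isometry_on [set: H] V2)
    (V12_commute : V1 \o V2 =1 V2 \o V1) :
  [<-> positive_operator (defect_operator V1 V2);
       V2 @` wandering V1 `<=` wandering V1;
       doubly_commuting V1 V2;
       is_projection (defect_operator V1 V2);
       isometry_on (wandering V1) (fringe2 V1 V2)].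
Proof.
tfae.
- exact: positive_invariant.
- exact: invariant_doubly_commuting.
- exact: doubly_commuting_projection.
- move=> /projection_positive C_ge0.
  by apply: invariant_fringe => //; exact: positive_invariant.
- move=> /(fringe_invariant V1_isometry V2_isometry) V2W.
  apply: projection_positive; apply: doubly_commuting_projection => //.
  exact: invariant_doubly_commuting.
Qed.
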